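(* Let $K>0$ and let $\Omega_K:[1,\infty)\to\mathbb{R}$ be the generalized Buchstab function defined by $\Omega_K(x)=1$ for $1\le x<2$ and $\Omega_K(x)=1+K\int_2^x\frac{\Omega_K(u-1)}{u-1}\,\mathrm{d}u$ for $x\ge 2$. For each integer $n\ge 1$, consider the Taylor expansion of $\Omega_K$ on the unit interval $[n,n+1)$ in the centered variable $z$: $$\Omega_K\Big(n+\frac{1+z}{2}\Big)=\sum_{i=0}^{\infty}c_{n,i}z^{i}\qquad\text{for } -1\le z<1.$$ For $n\ge 2$ and $i\ge 0$ let $$\alpha_i=\sum_{j=0}^{i}\frac{(-1)^{i-j}}{(2n-1)^{i-j}}c_{n-1,j}$$ (so $\alpha_i$ depends on $n$). Then $$c_{1,0}=1,\qquad c_{1,i}=0\ \text{ for } i\ge 1,$$ $$c_{2,0}=1+K\sum_{j=1}^{\infty}\frac{(-1)^{j-1}}{j2^{j}},\qquad c_{2,i}=K\sum_{j=i}^{\infty}\frac{(-1)^{j-1}}{j2^{j}}\binom{j}{i}\ \text{ for } i\ge 1,$$ $$c_{n,0}=\sum_{i=0}^{\infty}c_{n-1,i}-\frac{K}{2n-1}\sum_{i=0}^{\infty}\frac{(-1)^{i+1}\alpha_i}{i+1}\quad\text{for } n\ge 3,$$ $$c_{n,i}=\frac{K\alpha_{i-1}}{(2n-1)i}\quad\text{for } n\ge 3 \text{ and } i\ge 1.$$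
   Context: The variable $z\in[-1,1)$ corresponds to the fractional part $t=(1+z)/2\in[0,1)$ of $x=n+t\in[n,n+1)$. *)

(* Defs.v *)
From Stdlib Require Import Reals Factorial.
From Coquelicot Require Import Coquelicot.
Open Scope R_scope.

(* Functions on [1, oo) are represented by total functions whose values below 1
   are unconstrained.  The integrability clause is explicit because [RInt] is a
   total operator; the integrand only uses values of [Omega] on [1, x - 1]. *)
Definition is_buchstab (K : R) (Omega : R -> R) : Prop :=
  (forall x : R, 1 <= x < 2 -> Omega x = 1) /\
  (forall x : R, 2 <= x ->
     ex_RInt (fun u => Omega (u - 1) / (u - 1)) 2 x /\
     Omega x = 1 + K * RInt (fun u => Omega (u - 1) / (u - 1)) 2 x).

(* Taylor coefficients at z = 0, the midpoint of [n, n+1). *)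
Definition taylor_coef (Omega : R -> R) (n i : nat) : R :=
  Derive_n (fun z => Omega (INR n + (1 + z) / 2)) i 0 / INR (fact i).

Definition alpha (c : nat -> nat -> R) (n i : nat) : R :=
  sum_f_R0
    (fun j => (-1) ^ (i - j) / (2 * INR n - 1) ^ (i - j) * c (n - 1)%nat j) i.

Definition ex_series_from (m : nat) (a : nat -> R) : Prop :=
  ex_series (fun k => a (m + k)%nat).

Definition Series_from (m : nat) (a : nat -> R) : R :=
  Series (fun k => a (m + k)%nat).

(* Main.v *)
(** In the centered variable [z], [1/(x-1)] for [x = n + (1+z)/2] is [2/(2n-1+z)],
    a geometric series of radius [2n-1 >= 3].  Hence the recursive power series
    for [Omega] on [[n,n+1)], obtained by multiplying the previous one by this
    geometric series and integrating from [z = -1], all have radius of convergence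
    at least [3].  The endpoints [z = -1, 1] are therefore interior, so the series
    may be evaluated there, and they are the Taylor series at [z = 0].  For
    [n = 2] the stated coefficients come from the negative binomial series at
    [-1/2] and the integral of [1/(1+t)] over [[0,1/2]]. *)

Require Import Defs.
From Stdlib Require Import Reals Lra Lia.
From Coquelicot Require Import Coquelicot.
Open Scope R_scope.

(** * Power series: radii of convergence, geometric series, integration *)

Lemma CV_radius_ge (a : nat -> R) (r : R) :
  (forall x, Rabs x < r -> ex_pseries a x) -> Rbar_le r (CV_radius a).
Proof.
intros H; apply Rbar_not_lt_le; intros Hlt.
pose proof (CV_radius_ge_0 a) as H0.
destruct (CV_radius a) as [s | |] eqn:Es; simpl in Hlt, H0; try easy.
(* If the radius [s] were below [r], the midpoint of the two would lie outside the disk, where the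
   terms cannot tend to 0, yet within the range of assumed convergence. *)
assert (Habs : Rabs ((s + r) / 2) = (s + r) / 2) by (apply Rabs_pos_eq; lra).
apply (CV_disk_outside a ((s + r) / 2)).
  rewrite Es, Habs; simpl; lra.
apply ex_series_lim_0, ex_pseries_R, H; lra.
Qed.

Lemma CV_radius_mult (a b : nat -> R) (r : R) :
  Rbar_le r (CV_radius a) -> Rbar_le r (CV_radius b) ->
  Rbar_le r (CV_radius (PS_mult a b)).
Proof.
intros Ha Hb; apply CV_radius_ge; intros x Hx.
now apply ex_pseries_mult; apply Rbar_lt_le_trans with r.
Qed.

Lemma is_pseries_geom (q x : R) :
  Rabs (q * x) < 1 -> is_pseries (fun k => q ^ k) x (/ (1 - q * x)).
Proof.
intros Hx; apply is_pseries_R.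
apply is_series_ext with (fun k => (q * x) ^ k).
  intros k; apply Rpow_mult_distr.
now apply is_series_geom.
Qed.

Lemma CV_radius_geom (q : R) : q <> 0 -> CV_radius (fun k => q ^ k) = / Rabs q.
Proof.
intros Hq; apply CV_radius_finite_DAlembert.
- intros n; now apply pow_nonzero.
- now apply Rabs_pos_lt.
- apply is_lim_seq_ext with (fun _ => Rabs q); [|apply is_lim_seq_const].
  intros n; f_equal; simpl; field; now apply pow_nonzero.
Qed.

Definition PS_const (v : R) (i : nat) : R := match i with O => v | S _ => 0 end.

Lemma is_pseries_const (v x : R) : is_pseries (PS_const v) x v.
Proof.
apply is_pseries_R.
apply is_series_ext with (fun n => 0 ^ n * v).
  intros [|n]; simpl; ring.
assert (H : is_series (fun n => 0 ^ n) (/ (1 - 0)))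
  by (apply is_series_geom; rewrite Rabs_R0; lra).
apply (is_series_scal_r v) in H.
now replace (/ (1 - 0) * v) with v in H by field.
Qed.

Lemma is_RInt_PSeries_affine (a : nat -> R) (u v p q : R) :
  Rbar_lt (Rabs (u * p + v)) (CV_radius a) ->
  Rbar_lt (Rabs (u * q + v)) (CV_radius a) ->
  is_RInt (fun y => u * PSeries a (u * y + v)) p q
    (PSeries (PS_Int a) (u * q + v) - PSeries (PS_Int a) (u * p + v)).
Proof.
intros Hp Hq.
apply (is_RInt_comp_lin (PSeries a)).
replace (_ - _) with
  (- PSeries (PS_Int a) (u * p + v) + PSeries (PS_Int a) (u * q + v)) by ring.
(* Splitting at 0, where the antiderivative [PS_Int a] vanishes, leaves two integrals based at 0. *)
apply (is_RInt_Chasles (V := R_NormedModule)) with 0.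
- apply (is_RInt_swap (V := R_NormedModule)); now apply is_RInt_PSeries.
- now apply is_RInt_PSeries.
Qed.

(** * The integral equation and expansions about interval midpoints *)

Lemma buchstab_int (K : R) (Omega : R -> R) (y x l : R) :
  is_buchstab K Omega -> 2 <= y <= x ->
  is_RInt (fun u => Omega (u - 1) / (u - 1)) y x l ->
  Omega x = Omega y + K * l.
Proof.
intros [_ H] Hyx Hl.
destruct (H y) as [Ey ->]; [lra|].
destruct (H x) as [_ ->]; [lra|].
(* The integral from 2 to [y] is common to both equations and cancels, so later integrations can
   start at the left end of each unit interval. *)
rewrite <- (RInt_Chasles _ 2 y x Ey); [|now exists l].
rewrite (is_RInt_unique _ _ _ _ Hl).
unfold plus; simpl; ring.
Qed.

(* The value at [z = 1] is included: it is what makes the pieces match at the integers. *)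
Definition centered_expansion (Omega : R -> R) (n : nat) (a : nat -> R) : Prop :=
  Rbar_le 3 (CV_radius a) /\
  forall z, -1 <= z <= 1 -> PSeries a z = Omega (INR n + (1 + z) / 2).

Lemma CV_radius_3 (a : nat -> R) (z : R) :
  Rbar_le 3 (CV_radius a) -> -3 < z < 3 -> Rbar_lt (Rabs z) (CV_radius a).
Proof.
intros Ha Hz; apply Rbar_lt_le_trans with 3; [|exact Ha].
now apply Rabs_def1.
Qed.

(** Agreement near 0 fixes all derivatives there. Hence constructing any expansion yields a formula
    for the Taylor coefficients. *)
Lemma centered_expansion_coef (Omega : R -> R) (n : nat) (a : nat -> R) :
  centered_expansion Omega n a -> forall i, taylor_coef Omega n i = a i.
Proof.
intros [Hr Ha] i; unfold taylor_coef.
rewrite (Derive_n_ext_loc _ (PSeries a)).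
- rewrite Derive_n_coef by (apply Rbar_lt_le_trans with 3; [simpl; lra | exact Hr]).
  field; apply INR_fact_neq_0.
- exists (mkposreal 1 Rlt_0_1); intros t Ht.
  symmetry; apply Ha.
  unfold ball in Ht; simpl in Ht; unfold AbsRing_ball, abs, minus, plus, opp in Ht; simpl in Ht.
  apply Rabs_lt_between in Ht; lra.
Qed.

Lemma centered_expansion_ext (Omega : R -> R) (n : nat) (a b : nat -> R) :
  (forall i, a i = b i) ->
  centered_expansion Omega n a -> centered_expansion Omega n b.
Proof.
intros E [Hr Ha]; split.
- now rewrite <- (CV_radius_ext _ _ E).
- intros z Hz; rewrite <- (PSeries_ext _ _ _ E); now apply Ha.
Qed.

(** * Binomial series for the second interval *)

Lemma PS_mult_const_l (b : nat -> R) (i : nat) : PS_mult (PS_const 1) b i = b i.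
Proof.
unfold PS_mult; destruct i as [|i]; [simpl; ring|].
rewrite decomp_sum by lia.
rewrite sum_eq_R0 by (intros; simpl; ring).
simpl; ring.
Qed.

(** By induction on [i]: multiplying by the geometric series replaces the coefficients by their
    partial sums. *)
Lemma is_pseries_neg_binomial (i : nat) (x : R) :
  Rabs x < 1 ->
  is_pseries (fun k => Binomial.C (i + k) i) x (/ (1 - x) ^ S i).
Proof.
revert x; induction i as [|i IH]; intros x Hx.
- eapply is_pseries_ext; [|replace (/ (1 - x) ^ 1) with (/ (1 - 1 * x)) by (f_equal; ring);
    apply is_pseries_geom; now rewrite Rmult_1_l].
  intros k; simpl; now rewrite pow1, C_n_0.
- assert (Hx1 : 1 - x <> 0) by (apply Rabs_def2 in Hx; lra).
  replace (/ (1 - x) ^ S (S i)) with (/ (1 - x) ^ S i * / (1 - 1 * x))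
    by (rewrite Rmult_1_l; simpl; field; split; trivial; now apply pow_nonzero).
  eapply is_pseries_ext;
    [|apply (is_pseries_mult (fun k => Binomial.C (i + k) i) (fun k => 1 ^ k))].
  (* These partial sums are evaluated by the hockey-stick identity, proved from Pascal's rule. *)
  + intros n; unfold PS_mult; induction n as [|n IHn].
      simpl; rewrite Nat.add_0_r, !C_n_n; ring.
    rewrite tech5.
    rewrite (sum_eq _ (fun k => Binomial.C (i + k) i * 1 ^ (n - k)))
      by (intros; now rewrite !pow1).
    rewrite IHn, pow1, Rmult_1_r.
    replace (S i + S n)%nat with (S (S i + n)) by lia.
    rewrite <- pascal by lia.
    rewrite Rplus_comm; do 2 f_equal; lia.
  + now apply IH.
  + apply is_pseries_geom; now rewrite Rmult_1_l.
  + apply Rbar_lt_le_trans with 1; [exact Hx|].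
    apply CV_radius_ge; intros y Hy; eexists; now apply IH.
  + rewrite CV_radius_geom, Rabs_R1, Rinv_1; [exact Hx | lra].
Qed.

Lemma binomial_absorb (n i : nat) :
  (i <= n)%nat -> INR (S i) * Binomial.C (S n) (S i) = INR (S n) * Binomial.C n i.
Proof.
intros Hi; unfold Binomial.C.
replace (S n - S i)%nat with (n - i)%nat by lia.
rewrite !fact_simpl, !mult_INR.
field; repeat split; try apply INR_fact_neq_0; apply not_0_INR; lia.
Qed.

(** The constant term of [PS_Int a] is 0, so the sum may start at index 1; this shift produces the
    form of the sums in the theorem. *)
Lemma is_series_PS_Int (a : nat -> R) (x : R) :
  Rbar_lt (Rabs x) (CV_radius a) ->
  is_series (fun k => a k / INR (S k) * x ^ S k) (PSeries (PS_Int a) x).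
Proof.
intros Hx.
apply (is_series_incr_1 (fun k => PS_Int a k * x ^ k)).
replace (plus _ _) with (PSeries (PS_Int a) x)
  by (unfold plus; simpl; ring).
apply is_pseries_R, PSeries_correct, CV_radius_inside.
now rewrite CV_radius_Int.
Qed.

(** With j = i+1+k, absorption turns C(j,i+1)/j into C(j-1,i)/(i+1), leaving a negative binomial
    series at -1/2; the power of 3 comes from 1 + 1/2 = 3/2. *)
Lemma is_series_binomial_half (i : nat) :
  is_series (fun k => (-1) ^ (S i + k - 1) / (INR (S i + k) * 2 ^ (S i + k))
                      * Binomial.C (S i + k) (S i))
    ((-1) ^ i / (INR (S i) * 3 ^ S i)).
Proof.
pose proof (is_pseries_neg_binomial i (- / 2)) as H.
apply is_pseries_R in H; [|rewrite Rabs_Ropp, Rabs_pos_eq; lra].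
apply (is_series_scal_r ((-1) ^ i / (INR (S i) * 2 ^ S i))) in H.
pose proof (not_0_INR (S i) (Nat.neq_succ_0 i)) as Hi.
replace ((-1) ^ i / (INR (S i) * 3 ^ S i))
  with (/ (1 - - / 2) ^ S i * ((-1) ^ i / (INR (S i) * 2 ^ S i))).
- revert H; apply is_series_ext; intros k.
  replace (S i + k - 1)%nat with (i + k)%nat by lia.
  rewrite pow_add, (pow_add 2).
  replace (- / 2) with (-1 * / 2) by ring.
  rewrite Rpow_mult_distr, pow_inv.
  replace (Binomial.C (S i + k) (S i))
    with (INR (S i + k) * Binomial.C (i + k) i / INR (S i))
    by (change (S i + k)%nat with (S (i + k)); rewrite <- binomial_absorb by lia; field; trivial).
  apply Rminus_diag_uniq; field; repeat split; trivial; try (apply pow_nonzero; lra).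
  apply not_0_INR; lia.
- replace (1 - - / 2) with (3 * / 2) by field.
  rewrite Rpow_mult_distr, pow_inv.
  field; repeat split; trivial; apply pow_nonzero; lra.
Qed.

(** * Passage from one unit interval to the next *)

Section Recurrence.
Context (K : R) (Omega : R -> R) (HK : 0 < K) (HOmega : is_buchstab K Omega).

Lemma centered_expansion_1 : centered_expansion Omega 1 (PS_const 1).
Proof.
split.
- apply CV_radius_ge; intros x _; exists 1; apply is_pseries_const.
- intros z Hz; rewrite (is_pseries_unique _ _ _ (is_pseries_const 1 z)).
  destruct HOmega as [H1 H2]; simpl.
  destruct (Rle_lt_or_eq_dec z 1 (proj2 Hz)) as [Hlt | ->].
  + rewrite H1; lra.
  (* At z = 1 the argument is 2, governed by the integral equation, whose integral is over a single
     point. *)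
  + replace (1 + (1 + 1) / 2) with 2 by field.
    destruct (H2 2) as [_ ->]; [lra|].
    rewrite RInt_point; unfold zero; simpl; ring.
Qed.

(** Coefficients of r/(r+z) with r = 2n-1. The kernel 2/(r+z) is 2/r times this; the 2 cancels
    against dx = dz/2, which leaves the factor K/r in [next_coef]. *)
Definition geom_coef (n i : nat) : R := (- / (2 * INR n - 1)) ^ i.

(** The constant term joins the value at the left endpoint, which is the previous series at 1, to
    minus the scaled antiderivative at -1. *)
Definition next_coef (n : nat) (a : nat -> R) : nat -> R :=
  let P := PS_Int (PS_mult a (geom_coef n)) in
  PS_plus (PS_const (PSeries a 1 - K / (2 * INR n - 1) * PSeries P (-1)))
          (PS_scal (K / (2 * INR n - 1)) P).

Lemma next_coef_0 (n : nat) (a : nat -> R) :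
  next_coef n a 0 =
  PSeries a 1 - K / (2 * INR n - 1) * PSeries (PS_Int (PS_mult a (geom_coef n))) (-1).
Proof.
unfold next_coef.
set (v := _ - _); set (k := K / _).
transitivity (v + k * 0); [reflexivity | ring].
Qed.

Lemma next_coef_S (n i : nat) (a : nat -> R) :
  next_coef n a (S i) = K / (2 * INR n - 1) * (PS_mult a (geom_coef n) i / INR (S i)).
Proof.
unfold next_coef.
set (k := K / _).
transitivity (0 + k * (PS_mult a (geom_coef n) i / INR (S i))); [reflexivity | ring].
Qed.

(** The radius of the product series is recorded as well, because the formula for the constant
    coefficient sums its antiderivative at -1. *)
Lemma centered_expansion_S (m : nat) (a : nat -> R) :
  (1 <= m)%nat -> centered_expansion Omega m a ->
  Rbar_le 3 (CV_radius (PS_mult a (geom_coef (S m)))) /\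
  centered_expansion Omega (S m) (next_coef (S m) a).
Proof.
intros Hm [Hr Ha].
unfold next_coef.
set (r := 2 * INR (S m) - 1).
set (al := PS_mult a (geom_coef (S m))).
assert (Hm1 : 1 <= INR m) by (now apply (le_INR 1)).
assert (Hr3 : 3 <= r) by (unfold r; rewrite S_INR; lra).
assert (Hw : Rbar_le 3 (CV_radius (geom_coef (S m)))).
{ unfold geom_coef; fold r; rewrite CV_radius_geom.
  - rewrite Rabs_Ropp, Rabs_pos_eq, Rinv_inv by (left; apply Rinv_0_lt_compat; lra).
    exact Hr3.
  - apply Ropp_neq_0_compat, Rinv_neq_0_compat; lra. }
assert (Hal : Rbar_le 3 (CV_radius al)) by now apply CV_radius_mult.
assert (HP : forall z, -3 < z < 3 -> is_pseries (PS_Int al) z (PSeries (PS_Int al) z)).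
{ intros z Hz; apply PSeries_correct, CV_radius_inside.
  rewrite CV_radius_Int; now apply CV_radius_3. }
assert (Hval : forall z, -1 <= z <= 1 ->
  r * PSeries al z = Omega (INR m + (1 + z) / 2) * (r * r / (r + z))).
{ intros z Hz; unfold al; rewrite PSeries_mult by (apply CV_radius_3; trivial; lra).
  rewrite Ha by assumption.
  assert (Hq : is_pseries (geom_coef (S m)) z (r / (r + z))).
  { replace (r / (r + z)) with (/ (1 - - / r * z)) by (field; lra).
    apply is_pseries_geom.
    replace (- / r * z) with (- z / r) by (field; lra).
    apply Rabs_def1.
    - apply Rmult_lt_reg_r with r; [lra|]; field_simplify; lra.
    - apply Rmult_lt_reg_r with r; [lra|]; field_simplify; lra. }
  rewrite (is_pseries_unique _ _ _ Hq).
  field; lra. }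
split; [exact Hal|]; split.
- eapply Rbar_le_trans; [|apply CV_radius_plus].
  apply Rbar_min_case; [apply CV_radius_ge; intros x _; eexists; apply is_pseries_const|].
  rewrite CV_radius_scal, CV_radius_Int; [exact Hal|].
  apply Rgt_not_eq, Rdiv_lt_0_compat; lra.
- intros z Hz.
  rewrite PSeries_plus, PSeries_scal, (is_pseries_unique _ _ _ (is_pseries_const _ z)).
  2: eexists; apply is_pseries_const.
  2: apply ex_pseries_scal; [apply Rmult_comm|]; eexists; apply HP; lra.
  rewrite Ha by lra.
  (* Integration starts at the integer [INR (S m)], which is z = 1 on the previous interval and z =
     -1 on this one. *)
  rewrite (buchstab_int K Omega (INR (S m)) (INR (S m) + (1 + z) / 2)
            (/ r * (PSeries (PS_Int al) z - PSeries (PS_Int al) (-1)))).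
  + rewrite S_INR; replace (INR m + (1 + 1) / 2) with (INR m + 1) by field.
    field; lra.
  + exact HOmega.
  + rewrite S_INR; lra.
  (* The map y to 2y + v recovers z from the argument of [Omega]; its slope 2 is the Jacobian. *)
  + pose (v := - (2 * INR (S m) + 1)).
    assert (Hz0 : 2 * INR (S m) + v = -1) by (unfold v; ring).
    assert (Hz1 : 2 * (INR (S m) + (1 + z) / 2) + v = z) by (unfold v; field).
    pose proof (is_RInt_PSeries_affine al 2 v (INR (S m)) (INR (S m) + (1 + z) / 2)) as HI.
    rewrite Hz0, Hz1 in HI.
    apply is_RInt_ext with (fun y => scal (/ r) (2 * PSeries al (2 * y + v))).
    * intros x; rewrite Rmin_left, Rmax_right by lra; intros Hx.
      unfold scal; simpl; unfold mult; simpl.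
      assert (Hx' : 2 * x + v = 2 * x - 2 - r) by (unfold v, r; ring).
      assert (Hr' : r = 2 * INR m + 1) by (unfold r; rewrite S_INR; ring).
      rewrite S_INR in Hx.
      apply Rmult_eq_reg_l with r; [|lra].
      transitivity (2 / r * (r * PSeries al (2 * x + v))); [field; lra|].
      rewrite Hval by lra.
      replace (INR m + (1 + (2 * x + v)) / 2) with (x - 1) by lra.
      rewrite Hx'; field; lra.
    * apply (is_RInt_scal (V := R_NormedModule)), HI; apply CV_radius_3; trivial; lra.
Qed.

(** At each stage of the induction, uniqueness of coefficients replaces the constructed series by
    the Taylor series, which then feeds the next stage. *)
Lemma centered_expansion_taylor (n : nat) :
  (1 <= n)%nat -> centered_expansion Omega n (taylor_coef Omega n).
Proof.
induction 1 as [|m Hm IH].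
- apply centered_expansion_ext with (PS_const 1), centered_expansion_1.
  intros i; symmetry; apply centered_expansion_coef, centered_expansion_1.
- destruct (centered_expansion_S m _ Hm IH) as [_ H].
  eapply centered_expansion_ext; [|exact H].
  intros i; symmetry; now apply centered_expansion_coef.
Qed.

Lemma alpha_PS_mult (c : nat -> nat -> R) (m i : nat) :
  (1 <= m)%nat -> alpha c (S m) i = PS_mult (c m) (geom_coef (S m)) i.
Proof.
intros Hm; apply sum_eq; intros j _.
replace (S m - 1)%nat with m by lia.
unfold geom_coef; rewrite Rmult_comm; f_equal.
replace (- / (2 * INR (S m) - 1)) with (-1 * / (2 * INR (S m) - 1)) by ring.
now rewrite Rpow_mult_distr, pow_inv.
Qed.

End Recurrence.

(** * The coefficient formulas *)

Theorem theorem4 (K : R) (Omega : R -> R)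
  (HK : 0 < K) (HOmega : is_buchstab K Omega) :
  let c := taylor_coef Omega in
  (forall (n : nat) (z : R), (1 <= n)%nat -> -1 <= z < 1 ->
     is_pseries (c n) z (Omega (INR n + (1 + z) / 2))) /\
  c 1%nat 0%nat = 1 /\
  (forall i : nat, (1 <= i)%nat -> c 1%nat i = 0) /\
  (ex_series_from 1 (fun j => (-1) ^ (j - 1) / (INR j * 2 ^ j)) /\
   c 2%nat 0%nat =
     1 + K * Series_from 1 (fun j => (-1) ^ (j - 1) / (INR j * 2 ^ j))) /\
  (forall i : nat, (1 <= i)%nat ->
     ex_series_from i
       (fun j => (-1) ^ (j - 1) / (INR j * 2 ^ j) * Binomial.C j i) /\
     c 2%nat i =
       K * Series_from i
             (fun j => (-1) ^ (j - 1) / (INR j * 2 ^ j) * Binomial.C j i)) /\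
  (forall n : nat, (3 <= n)%nat ->
     ex_series (c (n - 1)%nat) /\
     ex_series (fun i => (-1) ^ (i + 1) * alpha c n i / INR (i + 1)) /\
     c n 0%nat =
       Series (c (n - 1)%nat)
       - K / (2 * INR n - 1)
         * Series (fun i => (-1) ^ (i + 1) * alpha c n i / INR (i + 1))) /\
  (forall n i : nat, (3 <= n)%nat -> (1 <= i)%nat ->
     c n i = K * alpha c n (i - 1) / ((2 * INR n - 1) * INR i)).

Proof.
intros c.
assert (HE : forall n, (1 <= n)%nat -> centered_expansion Omega n (c n))
  by now apply centered_expansion_taylor with K.
assert (Hconv : forall n z, (1 <= n)%nat -> -3 < z < 3 -> is_pseries (c n) z (PSeries (c n) z)).
{ intros n z Hn Hz; apply PSeries_correct, CV_radius_inside, CV_radius_3; [|exact Hz].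
  now apply HE. }
assert (H1 : forall i, c 1%nat i = PS_const 1 i).
{ apply centered_expansion_coef; now apply centered_expansion_1 with K. }
(* The recurrence is proved from n = 2 on, since that case also gives the closed form of [c 2 i]. *)
assert (HS : forall n i, (2 <= n)%nat -> (1 <= i)%nat ->
  c n i = K * alpha c n (i - 1) / ((2 * INR n - 1) * INR i)).
{ intros [|m] [|i] Hn Hi; try lia.
  destruct (centered_expansion_S K Omega HK HOmega m (c m) ltac:(lia) (HE m ltac:(lia)))
    as [_ HSm].
  unfold c at 1; rewrite (centered_expansion_coef _ _ _ HSm).
  rewrite alpha_PS_mult by lia.
  replace (S i - 1)%nat with i by lia.
  rewrite next_coef_S; field.
  split; [now apply not_0_INR|].
  apply le_INR in Hn; change (INR 2) with 2 in Hn; lra. }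
split; [|split; [|split; [|split; [|split; [|split]]]]].
- intros n z Hn Hz.
  destruct (HE n Hn) as [_ <-]; [|lra].
  apply Hconv; [exact Hn | lra].
- now rewrite H1.
- intros [|i] Hi; [lia | apply H1].
- assert (Hg : CV_radius (fun k => (-1) ^ k) = 1)
    by (rewrite CV_radius_geom by lra; f_equal; rewrite Rabs_left by lra; field).
  assert (Hsum : is_series (fun k => (-1) ^ (1 + k - 1) / (INR (1 + k) * 2 ^ (1 + k)))
    (PSeries (PS_Int (fun k => (-1) ^ k)) (/ 2))).
  { eapply is_series_ext; [|apply is_series_PS_Int].
    - intros k; replace (1 + k - 1)%nat with k by lia.
      change (1 + k)%nat with (S k); rewrite pow_inv; apply Rminus_diag_uniq; simpl pow; field.
      split; [apply pow_nonzero; lra | apply not_0_INR; lia].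
    - rewrite Hg, Rabs_pos_eq by lra; simpl; lra. }
  split; [eexists; exact Hsum|].
  unfold Series_from; rewrite (is_series_unique _ _ Hsum).
  (* The constant coefficient is the value at z = 0, that is [Omega] at 5/2; on [2, 5/2] the
     integrand is 1/(1+(u-2)), expanded in u-2. *)
  rewrite <- (PSeries_0 (c 2%nat)), (proj2 (HE 2%nat ltac:(lia))) by lra.
  rewrite (buchstab_int K Omega 2 _ (PSeries (PS_Int (fun k => (-1) ^ k)) (/ 2)) HOmega);
    [|simpl; lra|].
  + destruct HOmega as [_ H2]; destruct (H2 2) as [_ ->]; [lra|].
    rewrite RInt_point; unfold zero; simpl; ring.
  + pose proof (is_RInt_PSeries_affine (fun k => (-1) ^ k) 1 (-2) 2 (5 / 2)) as HI.
    replace (1 * 2 + -2) with 0 in HI by ring.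
    replace (1 * (5 / 2) + -2) with (/ 2) in HI by field.
    rewrite PSeries_0, Rminus_0_r, Hg, Rabs_R0, Rabs_pos_eq in HI by lra.
    replace (INR 2 + (1 + 0) / 2) with (5 / 2) by (simpl; field).
    eapply is_RInt_ext; [|apply HI; simpl; lra].
    intros u; rewrite Rmin_left, Rmax_right by lra; intros Hu.
    destruct HOmega as [HO _]; rewrite HO by lra.
    rewrite (is_pseries_unique _ _ _ (is_pseries_geom (-1) (1 * u + -2) ltac:(apply Rabs_def1; lra))).
    simpl; field; lra.
- intros [|i] Hi; [lia|].
  split; [eexists; apply is_series_binomial_half|].
  unfold Series_from; rewrite (is_series_unique _ _ (is_series_binomial_half i)).
  (* As [c 1] is the constant series 1, the product is the geometric series itself, with
     coefficients (-1/3)^i, matching the evaluated binomial sum. *)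
  rewrite HS, alpha_PS_mult by lia.
  replace (PS_mult _ _ _) with (geom_coef 2 i).
  + unfold geom_coef; replace (- / (2 * INR 2 - 1)) with (-1 * / 3) by (simpl; field).
    replace (2 * INR 2 - 1) with 3 by (simpl; ring).
    rewrite Rpow_mult_distr, pow_inv.
    simpl (3 ^ S i); field; split; [apply pow_nonzero; lra | now apply not_0_INR].
  + rewrite <- PS_mult_const_l; replace (S i - 1)%nat with i by lia.
    apply sum_eq; intros j _; now rewrite H1.
- intros [|m] Hn; [lia|].
  replace (S m - 1)%nat with m by lia.
  destruct (centered_expansion_S K Omega HK HOmega m (c m) ltac:(lia) (HE m ltac:(lia)))
    as [Hal HSm].
  assert (Hsum : is_series (fun i => (-1) ^ (i + 1) * alpha c (S m) i / INR (i + 1))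
    (PSeries (PS_Int (PS_mult (c m) (geom_coef (S m)))) (-1))).
  { eapply is_series_ext; [|apply is_series_PS_Int, CV_radius_3; [exact Hal | lra]].
    intros i; rewrite alpha_PS_mult, Nat.add_1_r by lia.
    apply Rminus_diag_uniq; unfold Rdiv; ring. }
  assert (Hc : forall i, c m i * 1 ^ i = c m i) by (intros i; rewrite pow1; ring).
  split; [|split].
  + apply ex_series_ext with (1 := Hc), ex_pseries_R.
    eexists; apply Hconv; [lia | lra].
  + eexists; exact Hsum.
  + rewrite (is_series_unique _ _ Hsum), <- (Series_ext _ _ Hc).
    unfold c at 1; rewrite (centered_expansion_coef _ _ _ HSm).
    apply next_coef_0.
- intros n i Hn Hi; apply HS; lia.
Qed.
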